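(* There exist some absolute constant $c$ and a parameter $r>0$ that depends only on $\lambda$ and $\delta$ (i.e. $r=r(\lambda,\delta)$) such that the following holds. Let $M$ be an ergodic Markov chain with state space $[n]$, stationary distribution $\pi$, and spectral expansion $\lambda=\lambda(M)$. Let $(V_1,\dots,V_t)$ denote a $t$-step random walk on $M$ starting from an initial distribution $\varphi$ on $[n]$, i.e., $V_1\leftarrow\varphi$. For every $i\in[t]$, let $f_i:[n]\to[0,1]$ be a weight function at step $i$ such that the expected weight $\mathrm{E}_{v\leftarrow\pi}[f_i(v)]=\mu$ for all $i$. Define the total weight of the walk $(V_1,\dots,V_t)$ by $X=\sum_{i=1}^t f_i(V_i)$. Then: 1. $\dfrac{\mathrm{E}[e^{rX}]}{e^{r(1+\delta)\mu t}}\le c\,\|\varphi\|_\pi\exp\left(-\delta^2(1-\lambda)\mu t/36\right)$ for $0\le\delta\le1$, and $\dfrac{\mathrm{E}[e^{rX}]}{e^{r(1+\delta)\mu t}}\le c\,\|\varphi\|_\pi\exp\left(-\delta(1-\lambda)\mu t/36\right)$ for $\delta>1$; 2. $\dfrac{\mathrm{E}[e^{-rX}]}{e^{-r(1-\delta)\mu t}}\le c\,\|\varphi\|_\pi\exp\left(-\delta^2(1-\lambda)\mu t/36\right)$ for $0\le\delta\le1$.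
   Context: $M$ denotes both the discrete-time Markov chain and its transition matrix; $M_{i,j}$ is the probability of moving from state $i$ to state $j$ in one step, and vectors are row vectors. The inner product under the $\pi$-kernel on $\mathbb{R}^n$ is $\langle u,v\rangle_\pi=\sum_{i\in[n]}u_iv_i/\pi(i)$, and the $\pi$-norm is $\|u\|_\pi=\sqrt{\langle u,u\rangle_\pi}$. The spectral expansion (spectral norm) of $M$ is $\lambda(M)=\max_{\langle x,\pi\rangle_\pi=0}\|xM\|_\pi/\|x\|_\pi$, the maximum being over nonzero $x\in\mathbb{R}^n$ with $\langle x,\pi\rangle_\pi=0$. The notation $v\leftarrow\pi$ means that $v$ is drawn from the distribution $\pi$.
   Formalization: The parameter r is required to be positive only when λ<1 and δ>0, and merely r≥0 when δ=0 or λ=1, since no r>0 can satisfy the bounds at those boundary values; the bounds themselves are kept on the whole range. *)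

(* Defs.v *)
From HB Require Import structures.
From mathcomp Require Import all_boot all_order all_algebra.
From mathcomp Require Import all_classical all_reals all_analysis.
Set Implicit Arguments.
Unset Strict Implicit.
Unset Printing Implicit Defensive.
Import Order.TTheory GRing.Theory Num.Theory.
Local Open Scope classical_set_scope.
Local Open Scope ring_scope.

Definition is_distribution (R : realType) (n : nat) (u : 'rV[R]_n) : Prop :=
  (forall i, 0 <= u 0 i) /\ \sum_i u 0 i = 1.

Definition is_stochastic (R : realType) (n : nat) (M : 'M[R]_n) : Prop :=
  forall i, is_distribution (row i M).

Definition irreducible_chain (R : realType) (n : nat) (M : 'M[R]_n) : Prop :=
  forall i j, exists k : nat, 0 < (M ^+ k) i j.

(* The gcd of the possible return times to any state is 1. *)
Definition aperiodic_chain (R : realType) (n : nat) (M : 'M[R]_n) : Prop :=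
  forall (i : 'I_n) (d : nat),
    (forall k : nat, (0 < k)%N -> 0 < (M ^+ k) i i -> (d %| k)%N) -> d = 1%N.

Definition ergodic_chain (R : realType) (n : nat) (M : 'M[R]_n) : Prop :=
  [/\ is_stochastic M, irreducible_chain M & aperiodic_chain M].

Definition is_stationary (R : realType) (n : nat) (M : 'M[R]_n)
    (pi : 'rV[R]_n) : Prop :=
  is_distribution pi /\ pi *m M = pi.

Definition inner_pi (R : realType) (n : nat) (pi u v : 'rV[R]_n) : R :=
  \sum_i u 0 i * v 0 i / pi 0 i.

Definition norm_pi (R : realType) (n : nat) (pi u : 'rV[R]_n) : R :=
  Num.sqrt (inner_pi pi u u).

(* For n > 1 and pi positive the supremum is attained, so it is the maximum.
   For n = 1 no nonzero x is orthogonal to pi and the value is sup set0 = 0. *)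
Definition spectral_expansion (R : realType) (n : nat) (pi : 'rV[R]_n)
    (M : 'M[R]_n) : R :=
  sup [set norm_pi pi (x *m M) / norm_pi pi x
      | x in [set x : 'rV[R]_n | x != 0 /\ inner_pi pi x pi = 0]].

(* The walk (V_1, ..., V_t) is indexed from 0.  The Markov property is written
   as P(V_1 = v_1, ..., V_{k+1} = v_{k+1})
        = P(V_1 = v_1, ..., V_k = v_k) * M_{v_k, v_{k+1}},
   which avoids conditioning on events of probability 0. *)
Definition is_random_walk (R : realType) (n t : nat) (M : 'M[R]_n)
    (phi : 'rV[R]_n) (d : measure_display) (T : measurableType d)
    (P : probability T R) (V : 'I_t -> T -> 'I_n) : Prop :=
  [/\ forall (i : 'I_t) (a : 'I_n), measurable (V i @^-1` [set a]),
      forall (i : 'I_t) (a : 'I_n), i = 0%N :> nat ->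
        P (V i @^-1` [set a]) = (phi 0 a)%:E
    & forall (i j : 'I_t) (v : 'I_t -> 'I_n), j = i.+1 :> nat ->
        P [set w | forall k : 'I_t, (k <= j)%N -> V k w = v k] =
        (P [set w | forall k : 'I_t, (k <= i)%N -> V k w = v k]
           * (M (v i) (v j))%:E)%E].

Definition total_weight (R : realType) (n t : nat) (T : Type)
    (f : 'I_t -> 'I_n -> R) (V : 'I_t -> T -> 'I_n) (w : T) : R :=
  \sum_(i < t) f i (V i w).

(* Main.v *)
Require Import Defs.
From HB Require Import structures.
From mathcomp Require Import all_boot all_order all_algebra.
From mathcomp Require Import all_classical all_reals all_analysis.
From mathcomp Require Import measurable_realfun ring lra.
Set Implicit Arguments.
Unset Strict Implicit.
Unset Printing Implicit Defensive.
Import Order.TTheory GRing.Theory Num.Theory.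
Local Open Scope classical_set_scope.
Local Open Scope ring_scope.

(* Conditioning on prefixes of the walk gives E[exp (s X)] = phi P_1 M ... P_t M 1,
   with P_i the diagonal matrix of exp (s f_i).  Split a row vector as
   x = a pi + y with y orthogonal to pi.  Multiplication by P_i M enlarges the
   stationary part at most by the factor 1 + (s + O(s^2)) mu, contracts the
   orthogonal part by about lambda, and leaks O(|s| sqrt mu) between the two.
   With |s| = r = (1 - lambda) m / 18 and m = min(delta, 1), the potential
   |a| + (m / 9) sqrt mu ||y||_pi therefore grows at each step at most by
   exp ((s + (19 / 81) r m) mu); the weight m / 9 is 2 r / (1 - lambda), so no
   division by 1 - lambda is needed and lambda = 1 is covered. *)

(** * Scalar inequalities and positivity of the stationary distribution *)

(** Lagrange's identity: the nonnegative double sum of [w i * w j * (a i * b j - a j * b i) ^+ 2] is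
    twice the right side minus the left. *)
Lemma sum_weighted_CS (R : realDomainType) (I : finType) (w a b : I -> R) :
  (forall i, 0 <= w i) ->
  (\sum_i w i * (a i * b i)) ^+ 2 <=
  (\sum_i w i * a i ^+ 2) * (\sum_i w i * b i ^+ 2).
Proof.
move=> w0.
have H : 0 <= \sum_i \sum_j w i * w j * (a i * b j - a j * b i) ^+ 2.
  apply: sumr_ge0 => i _; apply: sumr_ge0 => j _.
  by rewrite mulr_ge0 ?sqr_ge0 ?mulr_ge0.
set A := \sum_i w i * a i ^+ 2; set B := \sum_i w i * b i ^+ 2.
set C := \sum_i _.
suff E : \sum_i \sum_j w i * w j * (a i * b j - a j * b i) ^+ 2 =
    A * B + B * A - C * C *+ 2 by rewrite E in H; nra.
rewrite !big_distrlr /= -sumrMnl -big_split -sumrB /=.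
apply: eq_bigr => i _; rewrite -sumrMnl -big_split -sumrB /=.
by apply: eq_bigr => j _; ring.
Qed.

(** From [1 - z <= expR (- z)] follows [(1 - z) * expR z <= 1], while
    [(1 - z) * (1 + z + 2 * z ^+ 2)] is [1 + z ^+ 2 * (1 - 2 * z)], at least 1 in this range. *)
Lemma expR_le_quadratic (R : realType) (z : R) :
  `|z| <= 1 / 2 -> expR z <= 1 + z + 2 * z ^+ 2.
Proof.
move=> /ler_normlP [z1 z2].
have z0 : 0 < 1 - z by lra.
have : 1 - z <= expR (- z) by rewrite -[- z in leLHS]/(- z); exact: expR_ge1Dx.
rewrite expRN => H; have E0 := expR_gt0 z.
have H1 : (1 - z) * expR z <= 1.
  by have := ler_wpM2r (ltW E0) H; rewrite mulVf ?gt_eqF.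
rewrite -(ler_pM2l z0); apply: (le_trans H1).
have : 0 <= z ^+ 2 * (1 - 2 * z) by rewrite mulr_ge0 ?sqr_ge0 //; lra.
by move=> ?; nra.
Qed.

(** The quadratic term [2 * z ^+ 2] is at most [|z| / 9] here, whence the factor 10/9. *)
Lemma norm_expR_sub1 (R : realType) (z : R) :
  `|z| <= 1 / 18 -> `|expR z - 1| <= 10 / 9 * `|z|.
Proof.
move=> z18.
have z2 : expR z <= 1 + z + 2 * z ^+ 2 by apply: expR_le_quadratic; lra.
have z1 := expR_ge1Dx z.
rewrite -real_normK ?num_real // in z2.
have a0 := normr_ge0 z; have zl := ler_norm z; have zn := ler_norm (- z).
rewrite normrN in zn.
rewrite ler_norml; apply/andP; split; first lra.
nra.
Qed.

(** Some state [i] has positive mass, irreducibility carries part of it to [j] in [k] steps, and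
    [pi] is fixed by [M ^+ k]. *)
Lemma stationary_gt0 (R : realType) (n : nat) (M : 'M[R]_n) (pi : 'rV[R]_n) :
  is_stochastic M -> irreducible_chain M -> is_stationary M pi ->
  forall j, 0 < pi 0 j.
Proof.
move=> sM iM [[pi0 pi1] piM] j.
have [i pii] : exists i, 0 < pi 0 i.
  apply: contrapT => /forallNP pile.
  suff : \sum_i pi 0 i = 0 by rewrite pi1 => /eqP; rewrite oner_eq0.
  by apply: big1 => i _; apply: le_anti; rewrite pi0 leNgt andbT; apply/negP.
have [k Mk] := iM i j.
have Mge0 : forall l a b, 0 <= (M ^+ l) a b.
  elim=> [|l IH] a b; first by rewrite expr0 mxE ler0n.
  rewrite exprS mxE; apply: sumr_ge0 => c _; rewrite mulr_ge0 //.
  by have [+ _] := sM a => /(_ c); rewrite mxE.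
have piMk : pi *m M ^+ k = pi.
  elim: k {Mk} => [|k IH]; first by rewrite expr0 mulmx1.
  by rewrite exprS mulmxA piM.
rewrite -piMk mxE (bigD1 i) //= ltr_wpDr ?mulr_gt0 //.
by apply: sumr_ge0 => c _; rewrite mulr_ge0.
Qed.

(** * The Euclidean structure of the [pi]-norm *)

Section PiNorm.
Context (R : realType) (n : nat) (pi : 'rV[R]_n).
Hypothesis pi_gt0 : forall i, 0 < pi 0 i.

Let piV_ge0 i : 0 <= (pi 0 i)^-1.
Proof. by rewrite invr_ge0 ltW. Qed.

Lemma inner_pi_ge0 u : 0 <= inner_pi pi u u.
Proof.
by apply: sumr_ge0 => i _; rewrite mulr_ge0 // -expr2 sqr_ge0.
Qed.

Lemma norm_pi_ge0 u : 0 <= norm_pi pi u.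
Proof. exact: sqrtr_ge0. Qed.

Lemma sqr_norm_pi u : norm_pi pi u ^+ 2 = inner_pi pi u u.
Proof. by rewrite sqr_sqrtr // inner_pi_ge0. Qed.

Lemma inner_pi_CS u v : `|inner_pi pi u v| <= norm_pi pi u * norm_pi pi v.
Proof.
rewrite -(@ler_pXn2r _ 2) ?nnegrE ?mulr_ge0 ?norm_pi_ge0 //.
rewrite real_normK ?num_real // exprMn !sqr_norm_pi.
have /= := sum_weighted_CS (u 0) (v 0) piV_ge0.
by rewrite /inner_pi; congr (_ ^+ 2 <= _ * _); apply: eq_bigr => i _;
  rewrite mulrC ?expr2.
Qed.

Lemma norm_piD u v : norm_pi pi (u + v) <= norm_pi pi u + norm_pi pi v.
Proof.
rewrite -(@ler_pXn2r _ 2) ?nnegrE ?addr_ge0 ?norm_pi_ge0 //.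
have -> : norm_pi pi (u + v) ^+ 2 =
    norm_pi pi u ^+ 2 + inner_pi pi u v *+ 2 + norm_pi pi v ^+ 2.
  rewrite !sqr_norm_pi /inner_pi -sumrMnl -!big_split /=.
  by apply: eq_bigr => i _; rewrite !mxE; ring.
rewrite sqrrD lerD2r lerD2l lerMn2r /=.
exact: le_trans (ler_norm _) (inner_pi_CS _ _).
Qed.

Lemma norm_piZ a u : norm_pi pi (a *: u) = `|a| * norm_pi pi u.
Proof.
rewrite -sqrtr_sqr /norm_pi -sqrtrM ?sqr_ge0 //; congr Num.sqrt.
by rewrite /inner_pi big_distrr /=; apply: eq_bigr => i _; rewrite !mxE; ring.
Qed.

Lemma norm_pi0 : norm_pi pi 0 = 0.
Proof. by rewrite -(scale0r 0) norm_piZ normr0 mul0r. Qed.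

Lemma norm_pi_eq0 u : norm_pi pi u = 0 -> u = 0.
Proof.
move=> /eqP; rewrite sqrtr_eq0 => H.
have /eqP := le_anti (introT andP (conj H (inner_pi_ge0 u))).
rewrite psumr_eq0 => [/allP H0|i _]; last by rewrite mulr_ge0 // -expr2 sqr_ge0.
apply/rowP => i; rewrite mxE; move: (H0 i (mem_index_enum _)) => /=.
by rewrite !mulf_eq0 invr_eq0 (gt_eqF (pi_gt0 i)) orbF orbb => /eqP.
Qed.

(** Orthogonality to [pi] thus means coordinate sum zero, the form used from here on. *)
Lemma inner_pi_stationary x : inner_pi pi x pi = \sum_i x 0 i.
Proof. by apply: eq_bigr => i _; rewrite mulfK // gt_eqF. Qed.

Lemma norm_pi_le_pointwise (u v : 'rV[R]_n) (c : R) :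
  0 <= c -> (forall i, `|u 0 i| <= c * `|v 0 i|) ->
  norm_pi pi u <= c * norm_pi pi v.
Proof.
move=> c0 uv; rewrite -(ger0_norm c0) -norm_piZ; apply: ler_wsqrtr.
apply: ler_sum => i _; rewrite ler_wpM2r // -!expr2 mxE.
rewrite -[leLHS]real_normK ?num_real // -[leRHS]real_normK ?num_real //.
by rewrite normrM (ger0_norm c0) lerXn2r ?nnegrE ?mulr_ge0.
Qed.

End PiNorm.

(** * One step of the chain: contraction and the splitting along [pi] *)

Section StationaryChain.
Context (R : realType) (n : nat) (M : 'M[R]_n) (pi : 'rV[R]_n).
Hypothesis pi_gt0 : forall i, 0 < pi 0 i.
Hypothesis stochM : is_stochastic M.
Hypothesis statpi : is_stationary M pi.

Local Notation lam := (spectral_expansion pi M).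

Lemma stochastic_ge0 i j : 0 <= M i j.
Proof. by have [+ _] := stochM i => /(_ j); rewrite mxE. Qed.

Lemma sum_stochastic i : \sum_j M i j = 1.
Proof.
by have [_ <-] := stochM i; apply: eq_bigr => j _; rewrite mxE.
Qed.

Lemma sum_mulmx_stochastic (x : 'rV[R]_n) :
  \sum_j (x *m M) 0 j = \sum_i x 0 i.
Proof.
under eq_bigr do rewrite mxE.
rewrite exchange_big; apply: eq_bigr => i _ /=.
by rewrite -big_distrr /= sum_stochastic mulr1.
Qed.

Lemma norm_pi_mulmx (x : 'rV[R]_n) : norm_pi pi (x *m M) <= norm_pi pi x.
Proof.
have [_ piM] := statpi.
(* Cauchy-Schwarz with weights [pi 0 i * M i j] applied to [x 0 i / pi 0 i] and 1; the total weight
   is [pi 0 j] by stationarity. Summing over [j] then uses that rows of [M] sum to 1. *)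
have CS j : (x *m M) 0 j ^+ 2 / pi 0 j <= \sum_i M i j * (x 0 i ^+ 2 / pi 0 i).
  rewrite ler_pdivrMr //.
  have := sum_weighted_CS (fun i => x 0 i / pi 0 i) (fun=> 1)
    (fun i => mulr_ge0 (ltW (pi_gt0 i)) (stochastic_ge0 i j)).
  set a := (X in X ^+ 2 <= _); set b := (X in _ <= X * _).
  set e := (X in _ <= _ * X).
  have -> : a = (x *m M) 0 j.
    rewrite mxE; apply: eq_bigr => i _.
    by rewrite mulr1; field; rewrite gt_eqF.
  have -> : e = pi 0 j.
    rewrite -[in RHS]piM mxE; apply: eq_bigr => i _.
    by rewrite expr1n mulr1.
  suff -> : b = \sum_i M i j * (x 0 i ^+ 2 / pi 0 i) by [].
  by apply: eq_bigr => i _; field; rewrite gt_eqF.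
apply: ler_wsqrtr; rewrite /inner_pi.
apply: le_trans (_ : \sum_j \sum_i M i j * (x 0 i ^+ 2 / pi 0 i) <= _).
  by apply: ler_sum => j _; rewrite -expr2.
rewrite exchange_big; apply: ler_sum => i _ /=.
by rewrite -big_distrl /= sum_stochastic mul1r expr2.
Qed.

Let ratios := [set norm_pi pi (x *m M) / norm_pi pi x
  | x in [set x : 'rV[R]_n | x != 0 /\ inner_pi pi x pi = 0]].

Let ubound_ratios : ubound ratios 1.
Proof.
move=> _ [x [x0 _] <-].
have [|nx] := eqVneq (norm_pi pi x) 0.
  by move/(norm_pi_eq0 pi_gt0) => xE; rewrite xE eqxx in x0.
rewrite ler_pdivrMr ?mul1r ?norm_pi_mulmx //.
by rewrite lt_def nx norm_pi_ge0.
Qed.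

Lemma spectral_expansion_bounds : 0 <= lam <= 1.
Proof.
rewrite /spectral_expansion -/ratios.
have [->|/set0P ne] := eqVneq ratios set0; first by rewrite sup0 lexx ler01.
rewrite ge_sup // andbT; have [a ra] := ne.
apply: le_trans (ub_le_sup _ ra); last by exists 1.
by case: ra => x _ <-; rewrite divr_ge0 ?norm_pi_ge0.
Qed.

Lemma spectral_expansion_contracts (x : 'rV[R]_n) :
  \sum_i x 0 i = 0 -> norm_pi pi (x *m M) <= lam * norm_pi pi x.
Proof.
move=> x0; have [->|xN0] := eqVneq x 0.
  by rewrite mul0mx norm_pi0 mulr0.
have nx : 0 < norm_pi pi x.
  rewrite lt_def norm_pi_ge0 andbT; apply: contraNneq xN0.
  by move/(norm_pi_eq0 pi_gt0) => ->.
rewrite -ler_pdivrMr //; apply: ub_le_sup; first by exists 1.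
by exists x => //; split=> //; rewrite inner_pi_stationary.
Qed.

(** The component of [x] orthogonal to [pi]: the subtracted coefficient is the inner product with
    [pi], and a distribution [pi] has [pi]-norm 1. *)
Definition stationary_proj (x : 'rV[R]_n) := x - (\sum_i x 0 i) *: pi.

Lemma sum_stationary_proj x : \sum_i stationary_proj x 0 i = 0.
Proof.
have [[_ pi1] _] := statpi.
under eq_bigr do rewrite !mxE.
by rewrite big_split sumrN -big_distrr /= pi1 mulr1 subrr.
Qed.

Lemma norm_stationary_proj x : norm_pi pi (stationary_proj x) <= norm_pi pi x.
Proof.
have [[_ pi1] _] := statpi.
apply: ler_wsqrtr; set a := \sum_i x 0 i.
(* Pythagoras: the removed component has squared norm [a ^+ 2]. *)
suff -> : inner_pi pi (stationary_proj x) (stationary_proj x) =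
    inner_pi pi x x - a ^+ 2 by rewrite gerBl sqr_ge0.
transitivity (inner_pi pi x x - a *+ 2 * (\sum_i x 0 i) +
              a ^+ 2 * (\sum_i pi 0 i)); last by rewrite pi1 -/a; ring.
rewrite !big_distrr /= -sumrB -big_split /=.
apply: eq_bigr => i _; rewrite !mxE -/a.
by field; rewrite gt_eqF.
Qed.

Lemma norm_pi_stationary : norm_pi pi pi = 1.
Proof.
have [[_ pi1] _] := statpi.
by rewrite /norm_pi inner_pi_stationary // pi1 sqrtr1.
Qed.

(** Cauchy-Schwarz against the unit vector [pi]. *)
Lemma norm_pi_distribution_ge1 phi : is_distribution phi -> 1 <= norm_pi pi phi.
Proof.
move=> [_ phi1]; have := inner_pi_CS pi_gt0 phi pi.
by rewrite inner_pi_stationary // phi1 normr1 norm_pi_stationary mulr1.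
Qed.

End StationaryChain.

(** * One tilted step: growth of the potential *)

Definition tilt_mx (R : realType) (n : nat) (s : R) (h : 'I_n -> R) : 'M[R]_n :=
  diag_mx (\row_i expR (s * h i)).

Definition walk_potential (R : realType) (n : nat) (pi : 'rV[R]_n) (mu m : R)
    (x : 'rV[R]_n) : R :=
  `|\sum_i x 0 i| +
  m / 9 * Num.sqrt mu * norm_pi pi (stationary_proj pi x).

Section TiltedStep.
Context (R : realType) (n : nat) (M : 'M[R]_n) (pi : 'rV[R]_n).
Hypothesis pi_gt0 : forall i, 0 < pi 0 i.
Hypothesis stochM : is_stochastic M.
Hypothesis statpi : is_stationary M pi.
Context (mu m s : R).
Hypothesis m01 : 0 <= m <= 1.

Local Notation lam := (spectral_expansion pi M).
Local Notation r := ((1 - lam) * m / 18).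
Local Notation q := (10 / 9 * r).

Hypothesis s_r : `|s| = r.

Let lam01 : 0 <= lam <= 1 := spectral_expansion_bounds pi_gt0 stochM statpi.

Let r18 : 0 <= r <= 1 / 18.
Proof.
case/andP: lam01 => l0 l1; case/andP: m01 => m0 m1.
have : 0 <= lam * m by rewrite mulr_ge0.
have : 0 <= (1 - lam) * m by rewrite mulr_ge0 // subr_ge0.
by move=> ? ?; lra.
Qed.

Section OneStep.
Context (h : 'I_n -> R).
Hypothesis h01 : forall v, 0 <= h v <= 1.
Hypothesis h_mu : \sum_v pi 0 v * h v = mu.

Let e i := expR (s * h i).

Let sh i : `|s * h i| = r * h i.
Proof. by rewrite normrM s_r ger0_norm //; case/andP: (h01 i). Qed.

Let sh18 i : `|s * h i| <= 1 / 18.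
Proof.
rewrite sh; case/andP: (h01 i) => h0 h1; case/andP: r18 => r0 r1.
by rewrite -[leRHS]mulr1 ler_pM.
Qed.

Let e_sub1 i : `|e i - 1| <= q * h i.
Proof. by rewrite -mulrA -sh norm_expR_sub1. Qed.

Let e_le i : e i <= 1 + q.
Proof.
have := e_sub1 i; case/andP: (h01 i) => h0 h1; case/andP: r18 => r0 r1.
have : q * h i <= q by rewrite ler_piMr // mulr_ge0 //; lra.
by have := ler_norm (e i - 1); lra.
Qed.

Lemma mean_bounds : 0 <= mu <= 1.
Proof.
have [[_ pi1] _] := statpi.
rewrite -h_mu sumr_ge0 => [/=|i _]; last first.
  by rewrite mulr_ge0 // ?(ltW (pi_gt0 i)) //; case/andP: (h01 i).
rewrite -pi1; apply: ler_sum => i _.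
by rewrite ler_piMr // ?(ltW (pi_gt0 i)) //; case/andP: (h01 i).
Qed.

(** The quadratic bound on the exponential is averaged; [h i ^+ 2 <= h i] makes the error linear in
    [mu]. *)
Let mean_e : \sum_i pi 0 i * e i <= 1 + (s + 2 * r ^+ 2) * mu.
Proof.
have [[_ pi1] _] := statpi.
have -> : 1 + (s + 2 * r ^+ 2) * mu =
    \sum_i pi 0 i * (1 + (s + 2 * r ^+ 2) * h i).
  rewrite -h_mu mulr_sumr -[X in X + _]pi1 -big_split /=.
  by apply: eq_bigr => i _; ring.
apply: ler_sum => i _; case/andP: (h01 i) => h0 h1; rewrite ler_pM2l //.
have sh2 : `|s * h i| <= 1 / 2 by have := sh18 i; lra.
apply: le_trans (expR_le_quadratic sh2) _.
rewrite -[_ ^+ 2]real_normK ?num_real // sh.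
have : h i ^+ 2 <= h i by rewrite expr2 ler_piMr.
have : 0 <= r ^+ 2 by rewrite sqr_ge0.
rewrite [(r * h i) ^+ 2]exprMn; move: (r ^+ 2) (h i ^+ 2) => a b a0 bh.
by have := ler_wpM2l a0 bh; lra.
Qed.

Let tilted_pi : 'rV[R]_n := \row_i (pi 0 i * (e i - 1)).

(** The factor [Num.sqrt mu] of the leakage arises here: the squared norm is at most [q ^+ 2] times
    the mean of [h ^+ 2], and [h ^+ 2 <= h]. *)
Let norm_tilted_pi : norm_pi pi tilted_pi <= q * Num.sqrt mu.
Proof.
have q0 : 0 <= q by rewrite mulr_ge0 //; case/andP: r18.
rewrite -[q](ger0_norm q0) -sqrtr_sqr -sqrtrM ?sqr_ge0 //.
apply: ler_wsqrtr; rewrite -h_mu mulr_sumr; apply: ler_sum => i _.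
rewrite !mxE; case/andP: (h01 i) => h0 h1.
have -> : pi 0 i * (e i - 1) * (pi 0 i * (e i - 1)) / pi 0 i =
    pi 0 i * (e i - 1) ^+ 2 by field; rewrite gt_eqF.
rewrite [leRHS]mulrCA ler_pM2l // -real_normK ?num_real //.
apply: le_trans (_ : (q * h i) ^+ 2 <= _).
  by rewrite ler_pXn2r ?nnegrE // mulr_ge0.
rewrite exprMn ler_wpM2l ?sqr_ge0 //.
by rewrite expr2 ler_piMr.
Qed.

Lemma walk_potential_step x :
  walk_potential pi mu m (x *m (tilt_mx s h *m M)) <=
  (1 + (s + 2 * r ^+ 2 + m / 9 * q) * mu) * walk_potential pi mu m x.
Proof.
have [[_ pi1] piM] := statpi.
have [/andP[l0 l1] /andP[m0 m1]] := (lam01, m01).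
have [r0 r1] := andP r18; have /andP[mu0 mu1] := mean_bounds.
have q0 : 0 <= q by rewrite mulr_ge0.
rewrite /walk_potential.
set a := \sum_i x 0 i; set y := stationary_proj pi x.
set z := x *m tilt_mx s h.
have zE i : z 0 i = x 0 i * e i by rewrite /z /tilt_mx mul_mx_diag !mxE.
have y0 : \sum_i y 0 i = 0 := sum_stationary_proj statpi x.
have xE i : x 0 i = a * pi 0 i + y 0 i by rewrite !mxE -/a; ring.
clearbody y; set b := norm_pi pi y; have b0 : 0 <= b by exact: norm_pi_ge0.
have ye : `|\sum_i y 0 i * (e i - 1)| <= q * Num.sqrt mu * b.
  have -> : \sum_i y 0 i * (e i - 1) = inner_pi pi y tilted_pi.
    apply: eq_bigr => i _; rewrite [tilted_pi 0 i]mxE.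
    by field; rewrite gt_eqF.
  apply: le_trans (inner_pi_CS pi_gt0 _ _) _.
  by rewrite mulrC ler_wpM2r.
(* Since [y] has sum zero, each [e i] against [y] may be replaced by the small quantity
   [e i - 1]. *)
have sumz : \sum_i z 0 i =
    a * (\sum_i pi 0 i * e i) + \sum_i y 0 i * (e i - 1).
  have -> : \sum_i z 0 i = \sum_i z 0 i - \sum_i y 0 i by rewrite y0 subr0.
  rewrite mulr_sumr -sumrB -big_split /=.
  by apply: eq_bigr => i _; rewrite zE xE; ring.
have A0 : 0 <= \sum_i pi 0 i * e i.
  by apply: sumr_ge0 => i _; rewrite mulr_ge0 ?expR_ge0 // ltW.
have Ha : `|\sum_i z 0 i| <=
    (1 + (s + 2 * r ^+ 2) * mu) * `|a| + q * Num.sqrt mu * b.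
  rewrite sumz; apply: le_trans (ler_normD _ _) _; apply: lerD => //.
  by rewrite normrM mulrC (ger0_norm A0) ler_wpM2r.
(* [z] is [a *: pi + w], and the projection kills the multiple of [pi]; only a term of size [q]
   times [|a|] leaks into the orthogonal part. *)
set w := a *: tilted_pi + \row_i (y 0 i * e i).
have projz : stationary_proj pi z = stationary_proj pi w.
  have -> : z = a *: pi + w.
    by apply/rowP => i; rewrite zE !mxE xE; ring.
  rewrite /stationary_proj.
  under eq_bigr do rewrite mxE [(a *: pi) 0 _]mxE.
  rewrite big_split /= -mulr_sumr pi1 mulr1 scalerDl.
  by rewrite opprD addrACA subrr add0r.
have normw : norm_pi pi w <= `|a| * (q * Num.sqrt mu) + (1 + q) * b.
  apply: le_trans (norm_piD pi_gt0 _ _) _; apply: lerD.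
    by rewrite norm_piZ // ler_wpM2l.
  apply: norm_pi_le_pointwise => // [|i]; first by rewrite addr_ge0.
  by rewrite mxE normrM mulrC ler_wpM2r // ger0_norm ?expR_ge0.
have Hb : norm_pi pi (stationary_proj pi (x *m (tilt_mx s h *m M))) <=
    lam * (`|a| * (q * Num.sqrt mu) + (1 + q) * b).
  have -> : stationary_proj pi (x *m (tilt_mx s h *m M)) =
      stationary_proj pi z *m M.
    rewrite mulmxA -/z /stationary_proj sum_mulmx_stochastic //.
    by rewrite mulmxBl -scalemxAl piM.
  have := spectral_expansion_contracts pi_gt0 stochM statpi
    (sum_stationary_proj statpi z).
  move=> /le_trans; apply.
  rewrite ler_wpM2l // projz.
  exact: le_trans (norm_stationary_proj pi_gt0 statpi _) normw.
have -> : \sum_i (x *m (tilt_mx s h *m M)) 0 i = \sum_i z 0 i.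
  by rewrite mulmxA sum_mulmx_stochastic.
set S := Num.sqrt mu in Ha Hb *; have S0 : 0 <= S by exact: sqrtr_ge0.
have S2 : S ^+ 2 = mu by rewrite sqr_sqrtr.
have c0 : 0 <= m / 9 * S by rewrite mulr_ge0 // divr_ge0.
apply: le_trans (lerD Ha (ler_wpM2l c0 Hb)) _.
have a0 := normr_ge0 a.
(* Comparison of the coefficients of [|a|]: mass that leaks out returns weighted by [m / 9], with
   [lam <= 1]. *)
have Ca : m / 9 * S * (lam * (q * S)) <= m / 9 * q * mu.
  rewrite -S2 -subr_ge0.
  have -> : m / 9 * q * S ^+ 2 - m / 9 * S * (lam * (q * S)) =
     m / 9 * q * S ^+ 2 * (1 - lam) by ring.
  by rewrite !mulr_ge0 ?subr_ge0 // ?sqr_ge0.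
(* Comparison of the coefficients of [S * b]. The growth factor is at least [1 - r], even for
   negative [s]; every loss carries the factor [(1 - lam) * m] through [r], so the contraction gain
   [m / 9 * (1 - lam)] pays for all of them. *)
have Cb : q + m / 9 * (lam * (1 + q)) <=
    m / 9 * (1 + (s + 2 * r ^+ 2 + m / 9 * q) * mu).
  have s1 : - r <= s by rewrite -s_r lerNl -normrN ler_norm.
  have : 0 <= (2 * r ^+ 2 + m / 9 * q) * mu.
    by rewrite mulr_ge0 // addr_ge0 // mulr_ge0 ?sqr_ge0 ?divr_ge0.
  have smu : - r <= s * mu.
    apply: le_trans (_ : - r * mu <= _); last by rewrite ler_wpM2r.
    by rewrite mulNr lerN2 ler_piMr.
  move=> H.
  apply: le_trans (_ : m / 9 * (1 - r) <= _); last first.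
    by rewrite ler_wpM2l ?divr_ge0 //; lra.
  rewrite -subr_ge0.
  have -> : m / 9 * (1 - r) - (q + m / 9 * (lam * (1 + q))) =
    (1 - lam) * m * (8 / 162 - m / 162 - lam * m * 10 / 1458) by field.
  rewrite !mulr_ge0 ?subr_ge0 //.
  have : lam * m <= 1 by rewrite mulr_ile1.
  lra.
have := ler_wpM2r a0 Ca; have := ler_wpM2r (mulr_ge0 S0 b0) Cb.
lra.
Qed.

End OneStep.
End TiltedStep.

(* Entry [v] is the expectation of exp (s * weight) for the walk started at [v]
   whose successive states are weighted by the functions in [hs]. *)
Definition mgf_col (R : realType) (n : nat) (s : R) (M : 'M[R]_n)
    (hs : seq ('I_n -> R)) : 'cV[R]_n :=
  foldr (fun h acc => tilt_mx s h *m M *m acc) (const_mx 1) hs.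

Lemma mulmx_const1 (R : realType) (n : nat) (x : 'rV[R]_n) :
  (x *m const_mx 1 : 'M[R]_1) 0 0 = \sum_i x 0 i.
Proof. by rewrite mxE; apply: eq_bigr => i _; rewrite mxE mulr1. Qed.

(** * Iterating the step along the whole walk *)

Section MgfBound.
Context (R : realType) (n : nat) (M : 'M[R]_n) (pi : 'rV[R]_n).
Hypothesis pi_gt0 : forall i, 0 < pi 0 i.
Hypothesis stochM : is_stochastic M.
Hypothesis statpi : is_stationary M pi.
Context (mu m s : R).
Hypothesis m01 : 0 <= m <= 1.

Local Notation r := ((1 - spectral_expansion pi M) * m / 18).
Local Notation admissible h :=
  ((forall v, 0 <= h v <= 1) /\ \sum_v pi 0 v * h v = mu).

Hypothesis s_r : `|s| = r.

Lemma walk_potential_ge0 x : 0 <= walk_potential pi mu m x.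
Proof.
case/andP: m01 => m0 _.
by rewrite addr_ge0 // mulr_ge0 ?norm_pi_ge0 // mulr_ge0 ?sqrtr_ge0 ?divr_ge0.
Qed.

(** Induction on [hs] for all [x], each step being absorbed into the row vector. The bound
    [1 + u <= expR u] merges the growth factors into one exponential, and the potential dominates
    the final coordinate sum. *)
Lemma mgf_col_le_potential (hs : seq ('I_n -> R)) (x : 'rV[R]_n) :
  (forall k, (k < size hs)%N -> admissible (nth (fun=> 0) hs k)) ->
  (x *m mgf_col s M hs) 0 0 <=
  expR ((s + 2 * r ^+ 2 + m / 9 * (10 / 9 * r)) * mu * (size hs)%:R) *
  walk_potential pi mu m x.
Proof.
elim: hs x => [|h hs IH] x Hhs /=.
  rewrite mulr0 expR0 mul1r mulmx_const1; apply: le_trans (ler_norm _) _.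
  case/andP: m01 => m0 _; rewrite lerDl.
  by rewrite mulr_ge0 ?norm_pi_ge0 // mulr_ge0 ?sqrtr_ge0 ?divr_ge0.
have [h01 hmu] := Hhs 0%N isT.
rewrite mulmxA; apply: le_trans (IH _ _) _ => [k kl|]; first exact: (Hhs k.+1).
set g := s + 2 * r ^+ 2 + m / 9 * (10 / 9 * r).
have -> : g * mu * (size hs).+1%:R = g * mu * (size hs)%:R + g * mu.
  by rewrite -natr1 mulrDr mulr1.
rewrite expRD -[leRHS]mulrA ler_wpM2l ?expR_ge0 //.
apply: le_trans (walk_potential_step pi_gt0 stochM statpi m01 s_r h01 hmu x) _.
by rewrite ler_wpM2r ?walk_potential_ge0 ?expR_ge1Dx.
Qed.

(** Both summands are at most the norm of [phi], the first because that norm is at least 1. This is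
    the source of the constant 2. *)
Lemma walk_potential_distribution (phi : 'rV[R]_n) :
  0 <= mu <= 1 -> is_distribution phi ->
  walk_potential pi mu m phi <= 2 * norm_pi pi phi.
Proof.
move=> /andP[mu0 mu1] dphi; case/andP: m01 => m0 m1.
have := norm_pi_distribution_ge1 pi_gt0 statpi dphi.
have := norm_stationary_proj pi_gt0 statpi phi.
rewrite /walk_potential; case: dphi => _ ->; rewrite normr1.
have := norm_pi_ge0 pi (stationary_proj pi phi).
move: (norm_pi pi (stationary_proj pi phi)) (norm_pi pi phi) => a b a0 ab b1.
have : m / 9 * Num.sqrt mu * a <= 1 * a.
  rewrite ler_wpM2r // mulr_ile1 ?divr_ge0 ?sqrtr_ge0 //; first by lra.
  by rewrite -[leRHS]sqrtr1 ler_wsqrtr.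
lra.
Qed.

End MgfBound.

(** * The moment generating function of the walk as a matrix product *)

Section WalkMgf.
Context (R : realType) (n t : nat) (M : 'M[R]_n) (phi : 'rV[R]_n).
Context (d : measure_display) (T : measurableType d) (P : probability T R).
Context (V : 'I_t -> T -> 'I_n) (f : 'I_t -> 'I_n -> R) (s : R).
Hypothesis stochM : is_stochastic M.
Hypothesis walkV : is_random_walk M phi P V.
Hypothesis phi_distr : is_distribution phi.

(** Only the values of [v] below [k] matter; a total [v] lets prefixes of all lengths share one
    type. *)
Definition prefix_event (k : nat) (v : 'I_t -> 'I_n) : set T :=
  [set w | forall i : 'I_t, (i < k)%N -> V i w = v i].

Let update (v : 'I_t -> 'I_n) (j : 'I_t) (b : 'I_n) : 'I_t -> 'I_n :=
  fun i => if i == j then b else v i.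

Lemma measurable_prefix_event k v : measurable (prefix_event k v).
Proof.
have [mV _ _] := walkV.
suff -> : prefix_event k v =
    \bigcap_(i in [set i : 'I_t | (i < k)%N]) V i @^-1` [set v i].
  by apply: fin_bigcap_measurable => // i _; exact: mV.
by apply/seteqP; split=> w /=.
Qed.

Lemma measurable_total_weight : measurable_fun setT (total_weight f V).
Proof.
have [mV _ _] := walkV.
apply: measurable_sum => i.
(* Written as a finite combination of indicators of measurable events. *)
have -> : (fun w => f i (V i w)) =
    (fun w => \sum_a f i a * \1_(V i @^-1` [set a]) w).
  apply/funext => w; rewrite (bigD1 (V i w)) //= big1 => [|a /eqP aV].
    by rewrite indicE mem_set // mulr1 addr0.
  by rewrite indicE memNset ?mulr0 // => /esym.
by apply: measurable_sum => a; apply: measurable_funM.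
Qed.

Let prefix_split k v (kt : (k < t)%N) :
  prefix_event k v =
  \big[setU/set0]_(b <- enum 'I_n)
    prefix_event k.+1 (update v (Ordinal kt) b).
Proof.
rewrite -bigcup_seq; apply/seteqP; split=> w /=.
  move=> Aw; exists (V (Ordinal kt) w); first by rewrite /= mem_enum.
  move=> i; rewrite ltnS leq_eqVlt /update => /orP[/eqP ik|ik].
    have -> : i = Ordinal kt by apply: val_inj.
    by rewrite eqxx.
  by rewrite ifF ?Aw //; apply/eqP => iE; rewrite iE ltnn in ik.
move=> [b _ Aw] i ik; rewrite Aw ?ltnS 1?ltnW // /update ifF //.
by apply/eqP => iE; rewrite iE ltnn in ik.
Qed.

Let weight_upto k (v : 'I_t -> 'I_n) : R := \sum_(i < t | (i < k)%N) f i (v i).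

Let weight_update k v (kt : (k < t)%N) b :
  weight_upto k.+1 (update v (Ordinal kt) b) =
  weight_upto k v + f (Ordinal kt) b.
Proof.
rewrite /weight_upto (bigD1 (Ordinal kt)) //= addrC /update eqxx.
congr (_ + _); apply: eq_big => [i|i].
  by rewrite ltnS [RHS]ltn_neqAle andbC.
by case/andP => _ /negbTE ->.
Qed.

Let steps k := [seq f i | i <- drop k (enum 'I_t)].

Let steps_cons k (kt : (k < t)%N) :
  steps k = f (Ordinal kt) :: steps k.+1.
Proof.
rewrite /steps (drop_nth (Ordinal kt)) ?size_enum_ord //=.
by rewrite (nth_ord_enum (Ordinal kt) (Ordinal kt)).
Qed.

Let integrand := fun w => (expR (s * total_weight f V w))%:E.

Let measurable_integrand D : measurable_fun D integrand.
Proof.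
apply: measurable_funTS; apply/measurable_EFinP.
apply: measurableT_comp; first exact: measurable_expR.
by apply: measurable_funM => //; exact: measurable_total_weight.
Qed.

(* [nu] is the law of the next state given the prefix: [phi] for the empty
   prefix, the row of the last state of the prefix otherwise. *)
Lemma integral_prefix_event (k : nat) (v : 'I_t -> 'I_n) (nu : 'rV[R]_n) :
  (k <= t)%N -> \sum_i nu 0 i = 1 ->
  (forall (kt : (k < t)%N) b,
    fine (P (prefix_event k.+1 (update v (Ordinal kt) b))) =
    fine (P (prefix_event k v)) * nu 0 b) ->
  (\int[P]_(w in prefix_event k v) (expR (s * total_weight f V w))%:E)%E =
  (expR (s * weight_upto k v) * fine (P (prefix_event k v)) *
   (nu *m mgf_col s M (steps k)) 0 0)%:E.
Proof.
have [mV V0 VS] := walkV.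
have Pfin k' v' : P (prefix_event k' v') = (fine (P (prefix_event k' v')))%:E.
  by rewrite fineK // fin_num_measure //; exact: measurable_prefix_event.
(* Induction on the number [l] of states not yet fixed. When none is left the integrand is constant
   on the event. *)
move=> kt; move: {2}(t - k)%N (erefl (t - k)%N) => l tk.
elim: l k v nu tk kt => [|l IH] k v nu tk kt nu1 Hnu.
  have {tk kt} kt : k = t by apply/eqP; rewrite eqn_leq kt -subn_eq0 tk.
  rewrite {}kt in Hnu *.
  rewrite /steps drop_oversize ?size_enum_ord //= mulmx_const1 nu1 mulr1.
  transitivity (\int[P]_(w in prefix_event t v)
    cst (expR (s * weight_upto t v))%:E w)%E.
    apply: eq_integral => w /set_mem Aw; congr (expR (s * _))%:E.
    by apply: eq_big => [i|i _]; rewrite ?ltn_ord // Aw.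
  by rewrite integral_cst ?EFinM -?Pfin //; exact: measurable_prefix_event.
have {}kt : (k < t)%N by rewrite -subn_gt0 tk.
rewrite [X in integral _ X _](prefix_split v kt) ge0_integral_bigsetU; first last.
- by move=> w _; rewrite lee_fin expR_ge0.
- exact: measurable_integrand.
- move=> a b _ _ [w [Aa Ab]].
  have := Aa (Ordinal kt) (ltnSn _); have := Ab (Ordinal kt) (ltnSn _).
  by rewrite /update eqxx => -> .
- exact: enum_uniq.
- by move=> b; exact: measurable_prefix_event.
(* Once the next state [b] is fixed, the law of its successor is [row b M]; the Markov property
   supplies the hypothesis on [nu]. *)
under eq_bigr => b _.
  rewrite (IH k.+1 _ (row b M)); first last.
  - move=> kt' c.
    have := VS (Ordinal kt) (Ordinal kt')
      (update (update v (Ordinal kt) b) (Ordinal kt') c) erefl.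
    rewrite -/(prefix_event k.+2 _) -/(prefix_event k.+1 _).
    have -> : prefix_event k.+1
        (update (update v (Ordinal kt) b) (Ordinal kt') c) =
        prefix_event k.+1 (update v (Ordinal kt) b).
      have updE (i : 'I_t) : (i < k.+1)%N -> update (update v (Ordinal kt) b)
          (Ordinal kt') c i = update v (Ordinal kt) b i.
        move=> ik; rewrite /update ifF //; apply/eqP => iE.
        by rewrite iE ltnn in ik.
      by apply/seteqP; split=> w Aw i ik; rewrite (Aw i ik) updE.
    rewrite [in X in M X _]/update [in X in M _ X]/update !eqxx.
    have -> : (Ordinal kt == Ordinal kt') = false.
      by apply/eqP => /(congr1 val) /= /eqP; rewrite ltn_eqF.
    by move=> ->; rewrite Pfin -EFinM /= mxE.
  - by have [_ <-] := stochM b.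
  - exact: kt.
  - by rewrite subnS tk.
  rewrite weight_update Hnu.
  over.
rewrite big_enum /= sumEFin; congr EFin.
rewrite (steps_cons kt) /= -!mulmxA [in RHS]mxE mulr_sumr.
apply: eq_bigr => b _; rewrite mulrDr expRD.
have -> (D : 'cV_n) : (row b M *m D) 0 0 = (M *m D) b 0.
  by rewrite -row_mul mxE.
move: (M *m _) => D; rewrite mul_diag_mx !mxE; ring.
Qed.

Lemma expectation_mgf_col :
  ('E_P[fun w => expR (s * total_weight f V w)] =
   ((phi *m mgf_col s M [seq f i | i <- enum 'I_t]) 0 0)%:E)%E.
Proof.
have [mV V0 VS] := walkV; have [phi0 phi1] := phi_distr.
(* The empty prefix still needs a function to states; the state space is nonempty because [phi] sums
   to 1. *)
have [b0 _] : exists b : 'I_n, True.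
  apply: contrapT => /forallNP nob; move: phi1.
  rewrite big1 => [/esym/eqP|b _]; first by rewrite oner_eq0.
  by case: (nob b).
have A0 : prefix_event 0 (fun=> b0) = setT by apply/seteqP; split.
rewrite expectation.unlock -[X in integral _ X _]A0.
rewrite (@integral_prefix_event 0%N _ phi) //.
  rewrite A0 probability_setT /= mulr1 /weight_upto big1 //.
  by rewrite mulr0 expR0 mul1r /steps drop0.
move=> kt b; rewrite A0 probability_setT mul1r.
have /(f_equal fine) /= <- := V0 (Ordinal kt) b erefl.
congr (fine (P _)); apply/seteqP; split=> w /=.
  by move=> /(_ (Ordinal kt) (ltnSn _)); rewrite /update eqxx.
move=> Vb i; rewrite ltnS leqn0 => /eqP i0.
have -> : i = Ordinal kt by apply: val_inj.
by rewrite /update eqxx.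
Qed.

End WalkMgf.

(** * Choice of constants and the three tail bounds *)

Theorem claim3p2 (R : realType) :
  exists (c : R) (r : R -> R -> R),
    (forall lam delta : R, 0 <= lam <= 1 -> 0 <= delta ->
       0 <= r lam delta) /\
    (forall lam delta : R, 0 <= lam < 1 -> 0 < delta ->
       0 < r lam delta) /\
    forall (n : nat) (M : 'M[R]_n) (pi phi : 'rV[R]_n) (lam : R)
      (t : nat) (d : measure_display) (T : measurableType d)
      (P : probability T R) (V : 'I_t -> T -> 'I_n)
      (f : 'I_t -> 'I_n -> R) (mu delta : R),
      ergodic_chain M ->
      is_stationary M pi ->
      lam = spectral_expansion pi M ->
      is_distribution phi ->
      is_random_walk M phi P V ->
      (forall i v, 0 <= f i v <= 1) ->
      (forall i, \sum_v pi 0 v * f i v = mu) ->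
      let X := total_weight f V in
      let rho := r lam delta in
      (0 <= delta <= 1 ->
        ('E_P[fun w => expR (rho * X w)]
           / (expR (rho * (1 + delta) * mu * t%:R))%:E
         <= (c * norm_pi pi phi
             * expR (- (delta ^+ 2 * (1 - lam) * mu * t%:R / 36)))%:E)%E) /\
      (1 < delta ->
        ('E_P[fun w => expR (rho * X w)]
           / (expR (rho * (1 + delta) * mu * t%:R))%:E
         <= (c * norm_pi pi phi
             * expR (- (delta * (1 - lam) * mu * t%:R / 36)))%:E)%E) /\
      (0 <= delta <= 1 ->
        ('E_P[fun w => expR (- rho * X w)]
           / (expR (- rho * (1 - delta) * mu * t%:R))%:E
         <= (c * norm_pi pi phi
             * expR (- (delta ^+ 2 * (1 - lam) * mu * t%:R / 36)))%:E)%E).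
Proof.
(* Capping [delta] at 1 keeps the exponents [s * h v] within 1/18 in absolute value, where the
   bounds on the exponential apply. *)
exists 2, (fun lam delta => (1 - lam) * Num.min delta 1 / 18).
split=> [lam delta /andP[l0 l1] d0|].
  by rewrite !mulr_ge0 ?subr_ge0 // le_min d0 ler01.
split=> [lam delta /andP[l0 l1] d0|].
  by rewrite divr_gt0 // mulr_gt0 ?subr_gt0 // lt_min d0 ltr01.
move=> n M pi phi lam t d T P V f mu delta [stochM irrM _] statpi lamE dphi
  walkV f01 fmu X rho.
have pi_gt0 := stationary_gt0 stochM irrM statpi.
have /andP[l0 l1] := spectral_expansion_bounds pi_gt0 stochM statpi.
rewrite -lamE in l0 l1.
(* In every case s - a = - rho delta, so the total exponent is at most
   - (62 / 81) rho delta = - (62 / 1458) (1 - lam) m delta, and 62 / 1458 > 1 / 36. *)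
have key (s a x : R) : let m := Num.min delta 1 in
    0 <= delta -> `|s| = rho ->
    s + 19 / 81 * rho * m - a <= - x ->
    ('E_P[fun w => expR (s * X w)] / (expR (a * mu * t%:R))%:E <=
     (2 * norm_pi pi phi * expR (- (x * mu * t%:R)))%:E)%E.
  move=> m d0 s_rho sax.
  have m01 : 0 <= m <= 1 by rewrite le_min d0 ler01 ge_min lexx orbT.
  have /andP[m0 m1] := m01.
  rewrite (expectation_mgf_col _ _ stochM walkV dphi).
  rewrite inver gt_eqF ?expR_gt0 // -EFinM lee_fin -expRN.
  (* With [t = 0] there is no weight function to confine [mu] to the unit interval, but all
     exponents vanish. *)
  have [t0|t0] := posnP t.
    subst t; rewrite !mulr0 oppr0 expR0 !mulr1.
    have -> : enum 'I_0 = [::] by apply: size0nil; rewrite size_enum_ord.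
    rewrite /= mulmx_const1; have [_ ->] := dphi.
    by have := norm_pi_distribution_ge1 pi_gt0 statpi dphi; lra.
  have /andP[mu0 mu1] := mean_bounds pi_gt0 statpi (f01 (Ordinal t0)) (fmu _).
  rewrite /rho lamE in s_rho.
  have := @mgf_col_le_potential _ _ _ _ pi_gt0 stochM statpi mu m s m01 s_rho
    [seq f i | i <- enum 'I_t] phi.
  rewrite size_map size_enum_ord => /(_ _)/le_trans H.
  (* The constant is 19/81 = 9/81 + 10/81: [2 * rho ^+ 2] is at most [rho * m / 9], and the leakage
     contributes [10 / 81 * rho * m]. *)
  have Ebound : (phi *m mgf_col s M [seq f i | i <- enum 'I_t]) 0 0 <=
      expR ((s + 19 / 81 * rho * m) * mu * t%:R) * (2 * norm_pi pi phi).
    apply: H => [k kt|].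
      by rewrite (nth_map (Ordinal t0)) ?size_enum_ord.
    apply: ler_pM; rewrite ?expR_ge0 ?walk_potential_ge0 //.
      rewrite ler_expR !ler_wpM2r ?ler0n //.
      rewrite -lamE -/m -addrA lerD2l.
      have -> : (1 - lam) * m / 18 = rho by [].
      have -> : 2 * rho ^+ 2 = rho * m * (1 - lam) / 9.
        by rewrite /rho -/m; field.
      have rm0 : 0 <= rho * m by rewrite !mulr_ge0 // subr_ge0.
      have : rho * m * (1 - lam) <= rho * m by rewrite ler_piMr //; lra.
      lra.
    exact: (walk_potential_distribution pi_gt0 statpi m01
      (introT andP (conj mu0 mu1)) dphi).
  apply: le_trans (ler_wpM2r (expR_ge0 _) Ebound) _.
  rewrite mulrAC mulrC -expRD ler_wpM2l ?mulr_ge0 ?norm_pi_ge0 // ler_expR.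
  rewrite -!mulNr -!mulrDl.
  by rewrite !ler_wpM2r ?ler0n.
have rhoE : rho = (1 - lam) * Num.min delta 1 / 18 by [].
have ml : 0 <= (1 - lam) by lra.
split=> [/andP[d0 d1]|].
  have mE : Num.min delta 1 = delta by apply/min_idPl.
  rewrite mE in rhoE.
  have r0 : 0 <= rho by rewrite rhoE !mulr_ge0.
  have -> : delta ^+ 2 * (1 - lam) * mu * t%:R / 36 =
    delta ^+ 2 * (1 - lam) / 36 * mu * t%:R by field.
  apply: key => //; first exact: ger0_norm.
  have : 0 <= delta ^+ 2 * (1 - lam) by rewrite mulr_ge0 ?sqr_ge0.
  by rewrite mE rhoE; lra.
split=> [d1|/andP[d0 d1]].
  have mE : Num.min delta 1 = 1 by apply/min_idPr; rewrite ltW.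
  rewrite mE in rhoE.
  have r0 : 0 <= rho by rewrite rhoE !mulr_ge0.
  have -> : delta * (1 - lam) * mu * t%:R / 36 =
    delta * (1 - lam) / 36 * mu * t%:R by field.
  apply: key; [lra|exact: ger0_norm|].
  (* Here [m = 1], so [delta >= 1] is what bounds the error [19 / 81 * rho] by a multiple of
     [rho * delta]. *)
  have : 0 <= (delta - 1) * (1 - lam) by rewrite mulr_ge0 //; lra.
  by rewrite mE rhoE; lra.
have mE : Num.min delta 1 = delta by apply/min_idPl.
rewrite mE in rhoE.
have r0 : 0 <= rho by rewrite rhoE !mulr_ge0.
have -> : delta ^+ 2 * (1 - lam) * mu * t%:R / 36 =
  delta ^+ 2 * (1 - lam) / 36 * mu * t%:R by field.
(* The lower tail is the case [s = - rho], [a = - rho * (1 - delta)]. *)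
apply: key => //; first by rewrite normrN; exact: ger0_norm.
have : 0 <= delta ^+ 2 * (1 - lam) by rewrite mulr_ge0 ?sqr_ge0.
by rewrite mE rhoE; lra.
Qed.
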